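(* Let $0<\beta<1$ and let $A_T$, $\bar K$, $\hat K$ be as defined in the context. Then for all sufficiently large $T$, $$\sqrt{\hat K\beta}\cos\left(\tfrac{\pi}{T+1}\right)+\sqrt{\left(\hat K\cos^2\left(\tfrac{\pi}{T+1}\right)-\bar K\right)\beta}\;\le\;\sqrt{\rho(A_T)}\;\le\;\sqrt{\hat K\beta}+\sqrt{(\hat K-\bar K)\beta}.$$ In particular, for all sufficiently large $T$, $\hat K\beta\le\sqrt{\rho(A_T)\hat K\beta}$.
   Context: Let $0<\beta<1$, $\rho>0$, and $L_1,K_1>0$ with $\beta K_1<2$. (In the source, $L_1,K_1$ are Lipschitz constants of the cost and transition kernel of a finite-state mean-field game and $\rho$ is the strong convexity constant of a regularizer; only these numbers enter here.) Put $\bar L=\frac{L_1}{1-\beta K_1/2}$, $\bar K=\frac{3K_1}{2}+\frac{K_1\bar L}{2\rho(1-\beta)}$, $\hat K=\bar K+\frac{K_1\bar L}{\rho}$. For $T\ge2$, $A_T=(a_{ij})_{i,j=1}^{T-1}$ is the $(T-1)\times(T-1)$ matrix with $a_{ij}=\frac{\bar LK_1}{\rho}\beta^{\,j-i+1}$ for $j\ge i$, $a_{i,i-1}=\hat K$, and $a_{ij}=0$ for $j<i-1$. $\rho(A_T)$ denotes the spectral radius of $A_T$, while $\rho$ alone is the constant above. *)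

(* Defs.v *)
From HB Require Import structures.
From mathcomp Require Import all_boot all_order all_algebra.
From mathcomp Require Import all_classical all_reals all_analysis.
From mathcomp Require Export complex.
Import Order.TTheory GRing.Theory Num.Theory.
Import numFieldNormedType.Exports.

Set Implicit Arguments.
Unset Strict Implicit.
Unset Printing Implicit Defensive.

Local Open Scope classical_set_scope.
Local Open Scope ring_scope.

(* The eigenvalues are the complex ones, A being viewed in 'M[R[i]]_n.  They
   form a finite set, nonempty when 0 < n, so that [sup] is then a maximum. *)
Definition spectral_radius (R : realType) (n : nat) (A : 'M[R]_n) : R :=
  sup [set ComplexField.Normc.normc z |
        z in [set z : R[i] | eigenvalue (map_mx (real_complex R) A) z]].

Definition Lbar (R : realType) (beta L1 K1 : R) : R :=
  L1 / (1 - beta * K1 / 2).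

Definition Kbar (R : realType) (beta rho L1 K1 : R) : R :=
  3 * K1 / 2 + K1 * Lbar beta L1 K1 / (2 * rho * (1 - beta)).

Definition Khat (R : realType) (beta rho L1 K1 : R) : R :=
  Kbar beta rho L1 K1 + K1 * Lbar beta L1 K1 / rho.

(* Indices run over 0, ..., T - 2 instead of 1, ..., T - 1; the entries only
   depend on j - i, so the formulas are unaffected by the shift. *)
Definition AT (R : realType) (beta rho L1 K1 : R) (T : nat) : 'M[R]_(T.-1) :=
  \matrix_(i < T.-1, j < T.-1)
    if (i <= j)%N then Lbar beta L1 K1 * K1 / rho * beta ^+ (j - i + 1)%N
    else if i == j.+1 :> nat then Khat beta rho L1 K1
    else 0.

(* Main.v *)
(* With h = Khat, k = Kbar and b = beta, the difference of consecutive rows of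
   A w = mu w, for w_j = x_(j+1) / b^j, is the constant-coefficient recurrence
   mu x_(i+2) = (k b + mu) x_(i+1) - h b x_i with x_0 = 0, and the last row adds
   the boundary condition mu x_(n+1) = h b x_n, where n = T - 1.  If
   mu = s^2 and s^2 + k b = 2 sqrt(h b) s cos t, then x_i is proportional to
   (sqrt(h b) / s)^i sin(i t).

   At t = 0, s = sqrt(h b) + sqrt((h - k) b), this x is positive and
   A w <= mu w, so mu dominates the spectral radius of the nonnegative matrix A.
   At t = pi / (n + 2) the boundary residual mu x_(n+1) - h b x_n has the
   opposite sign, so the intermediate value theorem yields a real eigenvalue
   between the two values of mu. *)
Require Import Defs.
From mathcomp Require Import all_boot all_order all_algebra.
From mathcomp Require Import all_classical all_reals all_analysis.
From mathcomp Require Import ring lra.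
Import Order.TTheory GRing.Theory Num.Theory.
Import numFieldNormedType.Exports.

Local Open Scope classical_set_scope.
Local Open Scope ring_scope.

(** * Eigenvalues from column vectors *)

(** [eigenvalue] refers to row vectors; a nonzero column killed by [A - a%:M] makes this square
    matrix singular all the same. *)
Lemma eigenvalue_mulmx_col (F : fieldType) (n : nat) (A : 'M[F]_n) (a : F)
    (w : 'cV[F]_n) :
  A *m w = a *: w -> w != 0 -> eigenvalue A a.
Proof.
move=> Aw w0; rewrite /eigenvalue /eigenspace kermx_eq0 row_free_unit.
apply/negP => U; move/negP: w0; apply; apply/eqP.
by rewrite -(mulKmx U w) mulmxBl Aw mul_scalar_mx subrr mulmx0.
Qed.

(** Pair the moduli of a left eigenvector [v] with the positive column [w]: [|z| * S] is at most the
    sum of [|v_i| (A w)_i], hence at most [lambda * S], and [S > 0] cancels. *)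
Lemma normc_eigenvalue_le (R : realType) (n : nat) (A : 'M[R]_n) (lambda : R)
    (w : 'cV[R]_n) :
  (forall i j, 0 <= A i j) -> (forall i, 0 < w i 0) ->
  (forall i, (A *m w) i 0 <= lambda * w i 0) ->
  forall z : R[i], eigenvalue (map_mx (real_complex R) A) z ->
  ComplexField.Normc.normc z <= lambda.
Proof.
move=> A0 w0 Aw z /eigenvalueP[v vA v0].
pose C := real_complex R.
have C0 x : 0 <= x -> 0 <= C x by move=> ?; rewrite /C -(rmorph0 C) lecR.
have zE : `|z| = C (ComplexField.Normc.normc z) by case: z {vA} => a b; rewrite normc_def.
pose S := \sum_j `|v 0 j| * C (w j 0).
have S_gt0 : 0 < S.
  have [j vj] : exists j, v 0 j != 0.
    by case/matrix0Pn: v0 => i [j]; rewrite (ord1 i); exists j.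
  rewrite /S (bigD1 j) //= ltr_pwDl //.
    by rewrite mulr_gt0 ?normr_gt0 // /C -(rmorph0 C) ltcR.
  by apply: sumr_ge0 => i _; rewrite mulr_ge0 // C0 // ltW.
rewrite -lecR -/(C _) -zE -(ler_pM2r S_gt0).
have -> : `|z| * S = \sum_j `|\sum_i v 0 i * C (A i j)| * C (w j 0).
  rewrite mulr_sumr; apply: eq_bigr => j _.
  rewrite mulrA -normrM; congr (`|_| * _).
  by have /matrixP/(_ 0 j) := vA; rewrite !mxE => <-; apply: eq_bigr => i _; rewrite !mxE.
apply: (@le_trans _ _ (\sum_j \sum_i `|v 0 i| * C (A i j * w j 0))).
  apply: ler_sum => j _.
  apply: (@le_trans _ _ ((\sum_i `|v 0 i| * C (A i j)) * C (w j 0))).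
    rewrite ler_wpM2r ?(C0 _ (ltW (w0 j))) //; apply: (le_trans (ler_norm_sum _ _ _)).
    by apply: ler_sum => i _; rewrite normrM (ger0_norm (C0 _ (A0 i j))).
  by rewrite mulr_suml; apply: ler_sum => i _; rewrite /C rmorphM mulrA.
rewrite exchange_big /= mulr_sumr; apply: ler_sum => i _.
rewrite /C -mulr_sumr mulrCA ler_wpM2l // -rmorphM -rmorph_sum lecR.
by move: (Aw i); rewrite mxE.
Qed.

(** * The eigenvector recurrence and its closed form *)

(** By the recurrence, [d * b * x j.+1 = G j.+1 - G j], so the part of row [i] from the diagonal on
    telescopes. *)
Lemma geometric_hessenberg_mulmx (F : fieldType) (n : nat) (A : 'M[F]_n)
    (d h b mu : F) (x : nat -> F) :
  (forall i j : 'I_n, A i j =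
     if (i <= j)%N then d * b ^+ (j - i + 1)%N
     else if i == j.+1 :> nat then h else 0) ->
  b != 0 -> x 0 = 0 ->
  (forall i, mu * x i.+2 = (h * b - d * b + mu) * x i.+1 - h * b * x i) ->
  forall i : 'I_n,
    (A *m \col_(j < n) (x j.+1 / b ^+ j)) i 0 =
    mu * (x i.+1 / b ^+ i) - (mu * x n.+1 - h * b * x n) / b ^+ i.
Proof.
move=> AE b0 x0 xS i.
pose G j := h * b * x j - mu * x j.+1.
pose c j := (if (i <= j)%N then d * b ^+ (j - i + 1)%N
             else if i == j.+1 :> nat then h else 0) * (x j.+1 / b ^+ j).
have -> : (A *m \col_(j < n) (x j.+1 / b ^+ j)) i 0 = \sum_(0 <= j < n) c j.
  by rewrite mxE big_mkord; apply: eq_bigr => j _; rewrite AE mxE.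
rewrite (@big_cat_nat _ _ _ i) //=; last exact: ltnW.
(* Only the subdiagonal entry contributes; row 0 has none, which agrees with [x 0 = 0]. *)
have -> : \sum_(0 <= j < i) c j = h * b * x i / b ^+ i.
  rewrite /c; case: (nat_of_ord i) => [|m].
    by rewrite big_geq // x0 mulr0 mul0r.
  rewrite big_nat_recr //= ltnn eqxx big_nat_cond big1 ?add0r.
    by rewrite exprS; field; rewrite b0 expf_neq0.
  move=> j /andP[/andP[_ jm] _].
  by rewrite leqNgt ltnS (ltnW jm) /= eqSS gtn_eqF // mul0r.
rewrite (@telescope_sumr_eq _ i n (fun j => G j / b ^+ i)) ?(ltnW (ltn_ord i)) //.
  by rewrite /G; field; rewrite expf_neq0.
move=> j /andP[ij _]; rewrite /c ij /G xS.
have -> : b ^+ j = b ^+ (j - i) * b ^+ i by rewrite -exprD subnK.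
by rewrite exprD expr1; field; rewrite !expf_neq0.
Qed.

(* The solution of the recurrence of the header, multiplied by [mu ^+ i] to clear the
   denominators: [x i = (hess_poly H K i).[mu] / mu ^+ i] with [H = h b] and [K = k b]. *)
Fixpoint hess_poly (R : comNzRingType) (H K : R) (i : nat) {struct i} : {poly R} :=
  match i with
  | 0 => 0
  | i1.+1 =>
    if i1 is i2.+1 then
      (K%:P + 'X) * hess_poly R H K i1 - H%:P * 'X * hess_poly R H K i2
    else 1
  end.

Lemma horner_hess_polySS (R : comNzRingType) (H K mu : R) (i : nat) :
  (hess_poly R H K i.+2).[mu] =
  (K + mu) * (hess_poly R H K i.+1).[mu] - H * mu * (hess_poly R H K i).[mu].
Proof. by rewrite [hess_poly _ _ _ i.+2]/= !hornerE. Qed.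

(** With [c = cos t], [u i] stands for [sin (i t) / sin t]; leaving [u] abstract also covers the
    limit [u i = i] at [t = 0]. The factor [g] on the left avoids the exponent [i - 1]. *)
Lemma hess_poly_closed_form (R : comNzRingType) (H K mu g c : R) (u : nat -> R) :
  H * mu = g ^+ 2 -> K + mu = 2 * g * c ->
  u 0 = 0 -> u 1%N = 1 -> (forall i, u i.+2 = 2 * c * u i.+1 - u i) ->
  forall i, (hess_poly R H K i).[mu] * g = g ^+ i * u i.
Proof.
move=> Hmu Kmu u0 u1 uS i.
elim/ltn_ind: i => -[_|[_|i IH]]; first by rewrite /= horner0 u0; ring.
  by rewrite /= hornerE u1; ring.
rewrite horner_hess_polySS mulrBl -[_ * _ * g]mulrA IH // -[_ * _ * g]mulrA IH //.
by rewrite uS Kmu Hmu [g ^+ i.+2]exprS [g ^+ i.+1]exprS; ring.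
Qed.

(* The boundary residual [mu * x n.+1 - H * x n], multiplied by [mu ^+ n]. *)
Definition boundary_poly (R : comNzRingType) (H K : R) (n : nat) : {poly R} :=
  hess_poly R H K n.+1 - H%:P * hess_poly R H K n.

Lemma horner_boundary_poly (R : comNzRingType) (H K mu : R) (n : nat) :
  (boundary_poly R H K n).[mu] =
  (hess_poly R H K n.+1).[mu] - H * (hess_poly R H K n).[mu].
Proof. by rewrite /boundary_poly hornerD hornerN hornerM hornerC. Qed.

Lemma boundary_poly_closed_form (R : comNzRingType) (H K mu g c : R) (u : nat -> R) :
  H * mu = g ^+ 2 -> K + mu = 2 * g * c ->
  u 0 = 0 -> u 1%N = 1 -> (forall i, u i.+2 = 2 * c * u i.+1 - u i) ->
  forall n, (boundary_poly R H K n).[mu] * g = g ^+ n * (g * u n.+1 - H * u n).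
Proof.
move=> Hmu Kmu u0 u1 uS n.
rewrite horner_boundary_poly mulrBl -mulrA.
by rewrite !(@hess_poly_closed_form _ H K mu g c u) // exprS; ring.
Qed.

(** * Spectral bounds for the geometric Hessenberg matrix *)

Section GeometricHessenberg.
Variables (R : realType) (n : nat) (A : 'M[R]_n.+1) (k h b : R).
Hypothesis AE : forall i j : 'I_n.+1, A i j =
  if (i <= j)%N then (h - k) * b ^+ (j - i + 1)%N
  else if i == j.+1 :> nat then h else 0.
Hypotheses (b_gt0 : 0 < b) (k_gt0 : 0 < k) (kh : k < h).

Let h_gt0 : 0 < h. Proof. exact: lt_trans kh. Qed.

Let hb_gt0 : 0 < h * b. Proof. exact: mulr_gt0. Qed.

Let y i : {poly R} := hess_poly R (h * b) (k * b) i.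

Let w mu : 'cV[R]_n.+1 := \col_j ((y j.+1).[mu] / mu ^+ j.+1 / b ^+ j).

Let f := boundary_poly R (h * b) (k * b) n.+1.

Lemma hess_mulmx mu : 0 < mu -> forall i : 'I_n.+1,
  (A *m w mu) i 0 = mu * w mu i 0 - f.[mu] / mu ^+ n.+1 / b ^+ i.
Proof.
move=> mu_gt0 i; have mu0 : mu != 0 by rewrite gt_eqF.
rewrite (geometric_hessenberg_mulmx _ _ _ (h - k) h b mu
  (fun i => (y i).[mu] / mu ^+ i)) //.
- rewrite mxE /f horner_boundary_poly -!/(y _) (exprS _ n.+1) (exprS _ i).
  by field; rewrite !expf_neq0 ?mu0 // gt_eqF.
- by rewrite gt_eqF.
- by rewrite /y /= horner0 mul0r.
- move=> m; rewrite /y horner_hess_polySS (exprS _ m.+1) (exprS _ m).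
  by field; rewrite !expf_neq0 ?mu0.
Qed.

Lemma root_boundary_eigenvalue mu : 0 < mu -> root f mu -> eigenvalue A mu.
Proof.
move=> mu_gt0 /rootP fmu; apply: (eigenvalue_mulmx_col _ _ _ _ (w mu)).
  apply/matrixP => i j; rewrite (ord1 j) hess_mulmx // fmu !mul0r subr0.
  by rewrite [RHS]mxE.
apply/eqP => /matrixP/(_ 0 0); rewrite !mxE /y /= hornerE expr1 expr0 divr1 mul1r.
by move/eqP; rewrite invr_eq0 gt_eqF.
Qed.

(* The larger root [s] of [s ^+ 2 - 2 * Num.sqrt (h * b) * c * s + k * b]. *)
Let sc c := Num.sqrt (h * b) * c + Num.sqrt ((h * c ^+ 2 - k) * b).

(** The condition on [k] makes the discriminant nonnegative. The result is the relation between
    [mu = sc c ^+ 2] and [c] required by the closed form, with [g = Num.sqrt (h * b) * sc c]. *)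
Lemma sc_eq c : k <= h * c ^+ 2 ->
  k * b + sc c ^+ 2 = 2 * (Num.sqrt (h * b) * sc c) * c.
Proof.
move=> kc; have := @sqr_sqrtr R ((h * c ^+ 2 - k) * b).
rewrite mulr_ge0 ?subr_ge0 ?(ltW b_gt0) // => /(_ isT).
have := @sqr_sqrtr R (h * b); rewrite ltW // => /(_ isT).
rewrite /sc; move: (Num.sqrt _) (Num.sqrt _) => p q; nra.
Qed.

Let sqrt_hb_gt0 : 0 < Num.sqrt (h * b). Proof. by rewrite sqrtr_gt0. Qed.

Lemma sc_ge c : Num.sqrt (h * b) * c <= sc c.
Proof. by rewrite /sc lerDl sqrtr_ge0. Qed.

Lemma sc_gt0 c : 0 < c -> 0 < sc c.
Proof. by move=> c0; apply: lt_le_trans (sc_ge c); rewrite mulr_gt0. Qed.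

Lemma sc_le c : 0 <= c -> sc c <= 2 * (Num.sqrt (h * b) * c).
Proof.
move=> c0; rewrite /sc mulr_natl mulr2n lerD2l.
have -> : Num.sqrt (h * b) * c = Num.sqrt (h * b * c ^+ 2).
  by rewrite [RHS]sqrtrM ?(ltW hb_gt0) // sqrtr_sqr ger0_norm.
by rewrite ler_wsqrtr //; have := mulr_gt0 k_gt0 b_gt0; lra.
Qed.

Lemma ler_sc c c' : 0 <= c -> c <= c' -> sc c <= sc c'.
Proof.
move=> c0 cc; rewrite /sc lerD //; first by rewrite ler_wpM2l ?sqrtr_ge0.
rewrite ler_wsqrtr // ler_wpM2r ?(ltW b_gt0) // lerB // ler_wpM2l ?(ltW h_gt0) //.
by rewrite lerXn2r ?nnegrE // (le_trans c0).
Qed.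

Let H_sc c : h * b * sc c ^+ 2 = (Num.sqrt (h * b) * sc c) ^+ 2.
Proof. by rewrite exprMn sqr_sqrtr // ltW. Qed.

Lemma hb_le_sqrt_hb_sc1 : h * b <= Num.sqrt (h * b) * sc 1.
Proof.
rewrite -{1}(@sqr_sqrtr R (h * b)) ?(ltW hb_gt0) // expr2 ler_pM2l //.
by have := sc_ge 1; rewrite mulr1.
Qed.

Let natr_rec i : i.+2%:R = 2 * 1 * i.+1%:R - i%:R :> R.
Proof. by rewrite -natr1 -natr1; ring. Qed.

Let k_le_h1 : k <= h * 1 ^+ 2. Proof. by rewrite expr1n mulr1 ltW. Qed.

Lemma boundary_poly_sc1_gt0 : 0 < f.[sc 1 ^+ 2].
Proof.
have g_gt0 : 0 < Num.sqrt (h * b) * sc 1 by rewrite mulr_gt0 ?sc_gt0.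
rewrite -(pmulr_lgt0 _ g_gt0).
rewrite (boundary_poly_closed_form _ _ _ _ _ 1 (fun i => i%:R) (H_sc 1) (sc_eq 1 k_le_h1)) //.
(* The remaining factor [g * n.+2 - h * b * n.+1] is positive because [h * b <= g]. *)
rewrite mulr_gt0 ?exprn_gt0 // subr_gt0 -[n.+2]addn1 natrD mulrDr mulr1.
by rewrite ltr_pwDr // ler_wpM2r // hb_le_sqrt_hb_sc1.
Qed.

Lemma w_sc1_gt0 (j : 'I_n.+1) : 0 < w (sc 1 ^+ 2) j 0.
Proof.
have g_gt0 : 0 < Num.sqrt (h * b) * sc 1 by rewrite mulr_gt0 ?sc_gt0.
rewrite mxE !divr_gt0 ?exprn_gt0 ?sc_gt0 // -(pmulr_lgt0 _ g_gt0) /y.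
rewrite (hess_poly_closed_form _ _ _ _ _ 1 (fun i => i%:R) (H_sc 1) (sc_eq 1 k_le_h1)) //.
by rewrite mulr_gt0 ?exprn_gt0.
Qed.

Lemma hess_eigenvalue_le z : eigenvalue (map_mx (real_complex R) A) z ->
  ComplexField.Normc.normc z <= sc 1 ^+ 2.
Proof.
apply: (normc_eigenvalue_le _ _ _ _ (w (sc 1 ^+ 2))).
- move=> i j; rewrite AE; case: ifP => _; last by case: ifP => // _; exact: ltW.
  by rewrite mulr_ge0 ?exprn_ge0 ?subr_ge0 // ltW.
- exact: w_sc1_gt0.
- move=> i; rewrite hess_mulmx ?exprn_gt0 ?sc_gt0 // gerBl.
  by rewrite !divr_ge0 ?exprn_ge0 ?ltW ?boundary_poly_sc1_gt0 ?sc_gt0 // ltW // sc_gt0.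
Qed.

(** For a matrix of size [n.+1 = T - 1], the denominator [n.+3] is [T + 1]. *)
Let theta : R := pi / n.+3%:R.

Let theta_mul : n.+3%:R * theta = pi.
Proof. by rewrite /theta mulrC divfK // pnatr_eq0. Qed.

Let sin_theta_gt0 : 0 < sin theta.
Proof.
apply: sin_gt0_pi; rewrite divr_gt0 ?pi_gt0 //= /theta ltr_pdivrMr //.
by rewrite ltr_pMr ?pi_gt0 // ltr1n.
Qed.

Lemma cos_theta_gt0 : 0 < cos theta.
Proof.
apply: cos_gt0_pihalf; rewrite (@lt_trans _ _ 0) ?oppr_lt0 ?divr_gt0 ?pi_gt0 //=.
by rewrite /theta ltr_pM2l ?pi_gt0 // ltf_pV2 ?posrE // ltr_nat.
Qed.

(** Since [n.+3 * theta = pi], the two sines in the residual are [sin theta] and [sin (2 theta)].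
    Its sign is therefore that of [sc c - 2 * Num.sqrt (h * b) * c] at [c = cos theta], which
    [sc_le] settles. *)
Lemma boundary_poly_theta_le0 : k <= h * cos theta ^+ 2 ->
  f.[sc (cos theta) ^+ 2] <= 0.
Proof.
move=> kc; have c_gt0 := cos_theta_gt0.
have g_gt0 : 0 < Num.sqrt (h * b) * sc (cos theta) by rewrite mulr_gt0 ?sc_gt0.
rewrite -(pmulr_lle0 _ g_gt0).
rewrite (boundary_poly_closed_form _ _ _ _ _ (cos theta)
  (fun i => sin (i%:R * theta) / sin theta) (H_sc _) (sc_eq _ kc)).
- rewrite pmulr_rle0 ?exprn_gt0 //.
  have -> : n.+2%:R * theta = pi - theta.
    by rewrite -theta_mul -[n.+3]addn1 natrD; ring.
  have -> : n.+1%:R * theta = pi - theta *+ 2.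
    by rewrite -theta_mul -[n.+3]addn2 natrD mulr2n; ring.
  have sinpiB t : sin (pi - t) = sin t.
    by rewrite addrC sinDpi sinN opprK.
  rewrite !sinpiB sin_mulr2n -mulrnAl -!(mulrA _ (sin theta)) divff ?gt_eqF // !mulr1.
  rewrite subr_le0 -[X in _ <= X * _](sqr_sqrtr (ltW hb_gt0)) // expr2 -mulrA ler_pM2l //.
  by apply: le_trans (sc_le _ (ltW c_gt0)) _; rewrite mulr2n; lra.
- by rewrite mul0r sin0 mul0r.
- by rewrite mul1r divff ?gt_eqF.
- move=> i.
  have -> : i.+2%:R * theta = i.+1%:R * theta + theta by rewrite -natr1; ring.
  have -> : i%:R * theta = i.+1%:R * theta - theta by rewrite -natr1; ring.
  by rewrite sinD sinB; field; rewrite gt_eqF.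
Qed.

Lemma spectral_radius_hess_bounds : k <= h * cos theta ^+ 2 ->
  sc (cos theta) ^+ 2 <= spectral_radius A <= sc 1 ^+ 2.
Proof.
move=> kc; have c_gt0 := cos_theta_gt0.
have s_le : sc (cos theta) ^+ 2 <= sc 1 ^+ 2.
  by rewrite lerXn2r ?nnegrE ?(ltW (sc_gt0 _ _)) ?ler_sc ?cos_le1 ?(ltW c_gt0).
have [mu /andP[lo hi] fmu] := poly_ivt s_le
  (introT andP (conj (boundary_poly_theta_le0 kc) (ltW boundary_poly_sc1_gt0))).
have mu_gt0 : 0 < mu by apply: lt_le_trans lo; rewrite exprn_gt0 ?sc_gt0.
rewrite /spectral_radius; set E := image _ _.
have Emu : E mu.
  exists (real_complex R mu).
    by rewrite /= eigenvalue_map; exact: root_boundary_eigenvalue.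
  by rewrite /= expr0n addr0 sqrtr_sqr gtr0_norm.
(* Both bounds on the supremum use this: [E] must be bounded above for [mu] to lie below [sup E]. *)
have ubE : ubound E (sc 1 ^+ 2) by move=> _ [z ez <-]; exact: hess_eigenvalue_le.
apply/andP; split; last by apply: ge_sup => //; exists mu.
by apply: (le_trans lo); apply: ub_le_sup => //; exists (sc 1 ^+ 2).
Qed.

Lemma sqrt_spectral_radius_hess_bounds : k <= h * cos theta ^+ 2 ->
  sc (cos theta) <= Num.sqrt (spectral_radius A) <= sc 1.
Proof.
move=> kc; have /andP[lo hi] := spectral_radius_hess_bounds kc.
have sge0 c : 0 < c -> sc c = Num.sqrt (sc c ^+ 2).
  by move=> /sc_gt0 s0; rewrite sqrtr_sqr gtr0_norm.
by rewrite (sge0 _ cos_theta_gt0) (sge0 1) // !ler_wsqrtr.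
Qed.

End GeometricHessenberg.

(** * Application to [AT] for large [T] *)

Lemma near_cos_pi_div (R : realType) (a : R) : a < 1 ->
  exists T0 : nat, forall T : nat, (T0 <= T)%N -> a <= cos (pi / (T + 1)%N%:R).
Proof.
move=> a1.
have : cos (pi / n.+1%:R : R) @[n --> \oo] --> cos (0 : R).
  apply: continuous_cvg; first exact: continuous_cos.
  rewrite -[X in _ --> X](mulr0 pi); apply: cvgMl_tmp; exact: cvg_harmonic.
rewrite cos0 => /cvgr_ge /(_ _ a1) [T0 _ aT0].
by exists T0 => T T0T; rewrite addn1; exact: aT0.
Qed.

Theorem theorem3 (R : realType) (beta rho L1 K1 : R)
    (hbeta0 : 0 < beta) (hbeta1 : beta < 1) (hrho : 0 < rho)
    (hL1 : 0 < L1) (hK1 : 0 < K1) (hbK1 : beta * K1 < 2) :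
  let kbar := Kbar beta rho L1 K1 in
  let khat := Khat beta rho L1 K1 in
  let r := fun T : nat => spectral_radius (AT beta rho L1 K1 T) in
  (exists T0 : nat, forall T : nat, (2 <= T)%N -> (T0 <= T)%N ->
      Num.sqrt (khat * beta) * cos (pi / (T + 1)%N%:R)
        + Num.sqrt ((khat * cos (pi / (T + 1)%N%:R) ^+ 2 - kbar) * beta)
        <= Num.sqrt (r T)
      /\ Num.sqrt (r T)
        <= Num.sqrt (khat * beta) + Num.sqrt ((khat - kbar) * beta)) /\
  (exists T0 : nat, forall T : nat, (2 <= T)%N -> (T0 <= T)%N ->
      khat * beta <= Num.sqrt (r T * khat * beta)).
Proof.
move=> kbar khat r.
have q_gt0 : 0 < 1 - beta * K1 / 2 by lra.
have Lbar_gt0 : 0 < Lbar beta L1 K1 by rewrite /Lbar divr_gt0.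
have kbar_gt0 : 0 < kbar.
  by rewrite addr_gt0 // divr_gt0 // !mulr_gt0 // ?subr_gt0 ?ltr0n ?invr_gt0.
have khatB : khat - kbar = Lbar beta L1 K1 * K1 / rho.
  by rewrite /khat /Khat -/kbar addrC addKr [K1 * _]mulrC.
have kbar_lt : kbar < khat by rewrite -subr_gt0 khatB !mulr_gt0 ?invr_gt0.
have khat_gt0 : 0 < khat by apply: lt_trans kbar_lt.
(* The threshold is chosen so that [a <= c] means [khat + kbar <= 2 * khat * c], that is, [khat * (1
   - c) ^+ 2 <= khat * c ^+ 2 - kbar]. *)
pose a := (khat + kbar) / (2 * khat).
have a_lt1 : a < 1 by rewrite /a ltr_pdivrMr ?mulr_gt0 //; lra.
have [T0 cosT0] := near_cos_pi_div R a a_lt1.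
have cos_bound T : (T0 <= T)%N ->
    khat + kbar <= 2 * khat * cos (pi / (T + 1)%N%:R).
  by move=> /cosT0; rewrite /a ler_pdivrMr ?mulr_gt0 // mulrC.
have main T : (2 <= T)%N -> (T0 <= T)%N ->
    Num.sqrt (khat * beta) * cos (pi / (T + 1)%N%:R)
      + Num.sqrt ((khat * cos (pi / (T + 1)%N%:R) ^+ 2 - kbar) * beta)
      <= Num.sqrt (r T)
    /\ Num.sqrt (r T)
      <= Num.sqrt (khat * beta) + Num.sqrt ((khat - kbar) * beta).
  case: T => [|[|n]] // _ /cos_bound cb.
  have AE (i j : 'I_n.+1) : AT beta rho L1 K1 n.+2 i j =
      if (i <= j)%N then (khat - kbar) * beta ^+ (j - i + 1)%N
      else if i == j.+1 :> nat then khat else 0.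
    by rewrite mxE khatB.
  have := sqrt_spectral_radius_hess_bounds R n _ kbar khat beta AE hbeta0
    kbar_gt0 kbar_lt.
  rewrite -[n.+3]addn1 expr1n !mulr1 => /(_ _)/andP[]//.
  (* What is left is [kbar <= khat * c ^+ 2]: squaring [cb] gives [4 khat^2 c^2 >= (khat + kbar)^2
     >= 4 khat kbar]. *)
  move: (cos _) cb => c cb; nra.
split; first by exists T0.
exists T0 => T T2 T0T; have [lo _] := main T T2 T0T.
have := cos_bound T T0T; move: lo; move: (cos _) => c lo cb.
have hb_ge0 : 0 <= khat * beta by rewrite mulr_ge0 ?ltW.
have r_ge : Num.sqrt (khat * beta) <= Num.sqrt (r T).
  apply: le_trans lo; rewrite -lerBlDl.
  (* The cosine has been generalized to [c], so [c <= 1] is no longer at hand. *)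
  have [c1|c1] := lerP 1 c.
    by apply: le_trans (sqrtr_ge0 _); rewrite subr_le0 ler_peMr ?sqrtr_ge0.
  have -> : Num.sqrt (khat * beta) - Num.sqrt (khat * beta) * c =
      Num.sqrt (khat * beta * (1 - c) ^+ 2).
    by rewrite [RHS]sqrtrM // sqrtr_sqr gtr0_norm ?subr_gt0 // mulrBr mulr1.
  (* Comparing radicands leaves exactly the inequality for which [a] was chosen. *)
  rewrite ler_wsqrtr // mulrAC ler_wpM2r ?(ltW hbeta0) //; nra.
rewrite -mulrA [r T * _]mulrC sqrtrM // -{1}(sqr_sqrtr hb_ge0) expr2.
by rewrite ler_wpM2l ?sqrtr_ge0.
Qed.
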